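(* Suppose $M$ is a function on $\Sigma_A$ taking values in the set of all $d\times d$ non-negative matrices such that: (H1) there are matrices $M_1,\dots,M_m$ with $M(x)=M_i$ whenever $x\in[i]$, $i=1,\dots,m$; (H2) there exists an integer $r>0$ such that for any $i,j\in\{1,\dots,m\}$, $$\sum_{k=1}^r\ \sum_{K\in\Sigma_{A,k;i,j}}M_K>\mathbf{0}$$ (all entries strictly positive). Then the pressure function $P(q)$ is differentiable at any $q>0$.
   Context: Let $m\ge 2$, $\Sigma=\{1,\dots,m\}^{\mathbb{N}}$. Let $A$ be an $m\times m$ matrix with entries $0$ or $1$, assumed primitive (some power $A^p$ has all entries strictly positive). $\Sigma_A=\{x\in\Sigma: A_{x_k,x_{k+1}}=1\ \text{for all } k\}$ is the associated subshift of finite type. $\Sigma_{A,n}$ is the set of admissible words $J=j_1\cdots j_n$ of length $n$ over $\{1,\dots,m\}$ (that is, $A_{j_k,j_{k+1}}=1$ for $1\le k<n$), and $[J]=\{x\in\Sigma_A: x_i=j_i,\ 1\le i\le n\}$ is the cylinder set. $\Sigma_{A,k;i,j}$ is the set of all $K\in\Sigma_{A,k}$ such that the concatenation $iKj$ lies in $\Sigma_{A,k+2}$. For a word $J=j_1\cdots j_n$, $M_J=M_{j_1}\cdots M_{j_n}$. The matrix norm is $\|B\|=\mathbf{1}^tB\mathbf{1}$ with $\mathbf{1}^t=(1,\dots,1)$ (the sum of all entries). The pressure function, for $q>0$, is $$P(q)=\lim_{n\to\infty}\frac1n\log\sum_{J\in\Sigma_{A,n}}\|M_J\|^q,$$ the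 limit existing in this setting. *)

(* Defs.v *)
From mathcomp Require Export all_boot all_order all_algebra.
From mathcomp Require Export all_classical all_reals all_analysis.
Export Order.TTheory GRing.Theory Num.Theory.
Export numFieldNormedType.Exports.

Set Implicit Arguments.
Unset Strict Implicit.
Unset Printing Implicit Defensive.

Local Open Scope classical_set_scope.
Local Open Scope ring_scope.

(* The alphabet {1,...,m} is 'I_m, and sequences are indexed from 0. *)

Definition mx01 (m : nat) (A : 'M[nat]_m) : Prop :=
  forall i j, A i j = 0%N \/ A i j = 1%N.

Definition primitive_mx (m : nat) (A : 'M[nat]_m) : Prop :=
  exists2 p : nat, (0 < p)%N & forall i j, (0 < (A ^+ p) i j)%N.

Definition trans (m : nat) (A : 'M[nat]_m) : rel 'I_m :=
  fun i j => A i j == 1%N.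

Definition SFT (m : nat) (A : 'M[nat]_m) : set (nat -> 'I_m) :=
  [set x | forall k, trans A (x k) (x k.+1)].

Definition words (m : nat) (A : 'M[nat]_m) (n : nat) : {set n.-tuple 'I_m} :=
  finset (fun J : n.-tuple 'I_m => sorted (trans A) J).

Definition cylinder (m : nat) (A : 'M[nat]_m) (n : nat) (J : n.-tuple 'I_m) :
    set (nat -> 'I_m) :=
  [set x | SFT A x /\ forall k : 'I_n, x k = tnth J k].

Definition connecting_words (m : nat) (A : 'M[nat]_m) (k : nat) (i j : 'I_m) :
    {set k.-tuple 'I_m} :=
  finset (fun K : k.-tuple 'I_m =>
    (K \in words A k) && ([tuple of i :: rcons K j] \in words A k.+2)).

Definition word_mx (R : realType) (m d : nat) (Ms : 'I_m -> 'M[R]_d) (n : nat)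
    (J : n.-tuple 'I_m) : 'M[R]_d :=
  \prod_(k < n) Ms (tnth J k).

Definition sum_norm (R : realType) (d : nat) (B : 'M[R]_d) : R :=
  ((const_mx 1 : 'rV[R]_d) *m B *m (const_mx 1 : 'cV[R]_d)) 0 0.

(* [0 `^ q = 0] for [q != 0], so words with zero product do not contribute;
   the value of the quotient at [n = 0] is irrelevant to the limit. *)
Definition pressure (R : realType) (m d : nat) (A : 'M[nat]_m)
    (Ms : 'I_m -> 'M[R]_d) (q : R) : R :=
  lim ((fun n : nat =>
    n%:R^-1 * ln (\sum_(J in words A n) sum_norm (word_mx Ms J) `^ q)) @ \oo).

(* Main.v *)
Require Import Defs.
From mathcomp Require Import all_boot all_order all_algebra.
From mathcomp Require Import all_classical all_reals all_analysis.
From mathcomp Require Import zify ring lra.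

(** The pressure is convex, so it has one-sided derivatives a <= b at q, and
the point is to exclude a < b.

Only two properties of the weight phi(J) = ||M_J|| (set to 0 on words that are
not admissible) matter: it is submultiplicative under concatenation, and any
two words I, J can be joined by a word K of bounded length so that phi(IKJ) is
at least a constant times phi(I) phi(J); the latter is what the positivity
hypothesis (H2) yields.  Write Z q n I for the sum of phi(IL)^q over the words
L of length n.  Linking words give Z q n I >= c phi(I)^q Z q n [::] with c
independent of I and n ([partition_sum_ge]).  Hence ln (Z q n [::]) is additive
in n up to a constant, so it differs from n P(q) by a bounded amount
([ln_partition_sum_pressure]), locally uniformly in q.

Given a prefix I, the words J of length n carry the probability
  pi(J) = Z q l (I ++ J) / Z q (n + l) I,
the conditional law of the next n letters under the Gibbs measure with
exponent q.  The estimates above show that, up to constants independent of I,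
n, l and t, the moments of phi(J)^t under pi are at most
exp (n (P(q + t) - P(q))), and for negative t also at least that
([conditional_moments]).  Now put y = phi(J)^(1/n) exp(-b) and let n grow with
the exponents t/n of order 1/n.  If a < b, the negative moments of y of orders
t and 2t behave like those of a variable equal to exp(a - b) with a probability
bounded below, while a high positive moment stays bounded, so that y rarely
exceeds 1 by much.  This forces the mean of y below exp(-eta) for some
eta > 0, uniformly in I and l ([corner_block_bound]).

Because phi is submultiplicative, these conditional bounds can be chained over
consecutive blocks of length n, and they give
n (P(q + 1/n) - P(q)) <= b - eta ([pressure_slope_le_of_block_bound]).
But convexity makes the left-hand side at least b.  So there is no corner. *)

Set Implicit Arguments.
Unset Strict Implicit.
Unset Printing Implicit Defensive.

Local Open Scope classical_set_scope.
Local Open Scope ring_scope.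

(** * Sums over all words of a given length *)

Section AllWords.
Context {T : finType}.

Fixpoint all_words (n : nat) : seq (seq T) :=
  if n is n'.+1 then [seq x :: J | x <- enum T, J <- all_words n'] else [:: [::]].

Lemma mem_all_words n J : (J \in all_words n) = (size J == n).
Proof.
elim: n J => [|n IH] [|x J] /=; rewrite ?inE //.
- by apply/negbTE/allpairsPdep => -[x [K [_ _]]].
- rewrite eqSS -IH; apply/allpairsPdep/idP => [[y [K [_ KW [_ ->]]]]|JW] //.
  by exists x, J; rewrite mem_enum.
Qed.

Lemma uniq_all_words n : uniq (all_words n).
Proof.
elim: n => [|n IH] //=; apply: allpairs_uniq => //; first exact: enum_uniq.
by move=> [x K] [y L] _ _ /= [-> ->].
Qed.

Lemma big_all_words_cat (R : nmodType) n l (F : seq T -> R) :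
  \sum_(L <- all_words (n + l)) F L =
  \sum_(I <- all_words n) \sum_(J <- all_words l) F (I ++ J).
Proof.
elim: n F => [|n IH] F /=; first by rewrite big_seq1.
by rewrite !big_allpairs_dep /=; apply: eq_bigr => x _; rewrite (IH (F \o cons x)).
Qed.

Lemma big_all_words_tuple (R : nmodType) n (F : seq T -> R) :
  \sum_(J <- all_words n) F J = \sum_(J : n.-tuple T) F J.
Proof.
rewrite [RHS](_ : _ = \sum_(L <- map val (enum {: n.-tuple T})) F L); last first.
  by rewrite big_map big_enum.
apply: perm_big; apply: uniq_perm; first exact: uniq_all_words.
  by rewrite (map_inj_uniq val_inj) enum_uniq.
move=> J; rewrite mem_all_words; apply/eqP/mapP => [sJ|[t _ ->]].
  by exists (tcast sJ (in_tuple J)); rewrite ?mem_enum //= val_tcast.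
exact: size_tuple.
Qed.

End AllWords.

Section WeightedSums.
Context {R : realType} {T : finType}.
Implicit Types (F G H : seq T -> R).

Lemma ler_sum_words n F G :
  (forall J, size J = n -> F J <= G J) ->
  \sum_(J <- all_words n) F J <= \sum_(J <- all_words n) G J.
Proof.
move=> FG; rewrite big_seq [leRHS]big_seq; apply: ler_sum => J.
by rewrite mem_all_words => /eqP; exact: FG.
Qed.

Lemma sum_words_ge n F J : (forall K, 0 <= F K) -> size J = n ->
  F J <= \sum_(K <- all_words n) F K.
Proof.
move=> F0 sJ; rewrite (bigD1_seq J) ?uniq_all_words ?mem_all_words ?sJ //=.
by rewrite lerDl sumr_ge0.
Qed.

(** A sum over words of length n is controlled by a sum over words of length n + r
as soon as each short word can be padded on both sides without losing too much
of its weight.  A long word arises from at most r + 1 short ones, one for each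
length of its left padding; this is where the factor comes from. *)
Lemma sum_words_padding r n G H : (forall L, 0 <= H L) ->
  (forall J, size J = n ->
    exists K E, (size K + size E)%N = r /\ G J <= H (K ++ J ++ E)) ->
  \sum_(J <- all_words n) G J <= r.+1%:R * \sum_(L <- all_words (n + r)) H L.
Proof.
move=> H0 GH.
apply: (@le_trans _ _ (\sum_(J <- all_words n) \sum_(k < r.+1)
    \sum_(K <- all_words k) \sum_(E <- all_words (r - k)) H (K ++ J ++ E))).
  apply: ler_sum_words => J /GH [K [E [sKE /le_trans]]]; apply.
  have kr : (size K < r.+1)%N by lia.
  have h0 : forall K E, 0 <= H (K ++ J ++ E) by [].
  rewrite (bigD1 (Ordinal kr)) //= -[leLHS]addr0 lerD //; last first.
    by rewrite sumr_ge0 // => i _; do 2 (rewrite sumr_ge0 // => ? _).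
  apply: (@le_trans _ _ (\sum_(E <- all_words (r - size K)) H (K ++ J ++ E))).
    by apply: (@sum_words_ge _ (fun E => H (K ++ J ++ E))) => //; lia.
  apply: (@sum_words_ge _ (fun K => \sum_(E <- _) H (K ++ J ++ E))) => // L.
  by rewrite sumr_ge0.
rewrite exchange_big /= -[r.+1 in leRHS]card_ord -sum1_card natr_sum mulr_suml.
apply: ler_sum => k _; rewrite mul1r exchange_big /=.
have -> : (n + r = k + (n + (r - k)))%N by have := ltn_ord k; lia.
rewrite big_all_words_cat le_eqVlt; apply/orP; left; apply/eqP.
by apply: eq_bigr => K _; rewrite big_all_words_cat.
Qed.

End WeightedSums.

(** * Real analysis *)

Lemma powR_le_base {R : realType} (q x y : R) :
  0 <= q -> 0 <= x -> x <= y -> x `^ q <= y `^ q.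
Proof.
by move=> q0 x0 xy; apply: ge0_ler_powR => //; rewrite nnegrE // (le_trans x0).
Qed.

Lemma bounded_multiples_le0 {R : realType} (x C : R) :
  (forall n : nat, n%:R * x <= C) -> x <= 0.
Proof.
move=> h; rewrite leNgt; apply/negP => x0.
have C0 : 0 <= C by have := h 0%N; rewrite mul0r.
have := archi_boundP (divr_ge0 C0 (ltW x0)); rewrite ltr_pdivrMr //.
by have := h (Num.bound (C / x)); lra.
Qed.

(** Comparing a (k n) with k (a n) and with n (a k) shows that every
(a n - C) / n lies below every (a k + C) / k, so the
supremum of the former is the limit and a stays close to a linear sequence. *)
Lemma near_additive_limit {R : realType} (a : nat -> R) (C : R) :
  (forall n l, `|a (n + l)%N - (a n + a l)| <= C) ->
  forall n : nat, `|a n - n%:R * lim (k%:R^-1 * a k @[k --> \oo])| <= C.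
Proof.
move=> add.
have C0 : 0 <= C by apply: le_trans (add 0 0)%N.
have mult n k : `|a (k.+1 * n)%N - k.+1%:R * a n| <= k%:R * C.
  elim: k => [|k IH]; first by rewrite mul1n mul1r subrr normr0 mul0r.
  rewrite mulSn.
  have := add n (k.+1 * n)%N; move: IH; rewrite !ler_norml -[in k.+2%:R]addn1 natrD.
  rewrite -[in k.+1%:R * C]addn1 natrD; lra.
pose S := [set x | exists n, x = n.+1%:R^-1 * (a n.+1 - C)].
have ubS k : ubound S (k.+1%:R^-1 * (a k.+1 + C)).
  move=> _ [n ->]; rewrite ler_pdivrMl ?ltr0n // mulrCA ler_pdivlMl ?ltr0n //.
  have := mult n.+1 k; have := mult k.+1 n.
  rewrite [(k.+1 * _)%N]mulnC !ler_norml -![in (_.+1)%:R]addn1 !natrD; lra.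
have S0 : S !=set0 by exists (1%:R^-1 * (a 1%N - C)), 0%N.
have hS : has_sup S by split=> //; exists (1%:R^-1 * (a 1%N + C)); exact: (ubS 0%N).
have bnd n : `|a n - n%:R * sup S| <= C.
  case: n => [|n]; first by have := add 0%N 0%N; rewrite mul0r !ler_norml; lra.
  have n0 : 0 < n.+1%:R :> R by rewrite ltr0n.
  have lo : n.+1%:R^-1 * (a n.+1 - C) <= sup S by apply: ub_le_sup; [case: hS | exists n].
  have hi : sup S <= n.+1%:R^-1 * (a n.+1 + C) by apply: sup_le_ub => //; exact: ubS.
  move: lo hi; rewrite ler_pdivrMl // ler_pdivlMl // ler_norml; lra.
suff -> : lim (k%:R^-1 * a k @[k --> \oo]) = sup S by [].
apply/cvg_lim => //; apply/cvgrPdist_le => e e0.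
near=> k.
have k0 : 0 < k%:R :> R by near: k; exact: nbhs_infty_gtr.
rewrite distrC -(ler_pM2l k0) -[X in X * _ <= _](gtr0_norm k0) -normrM mulrBr.
rewrite mulVKf ?gt_eqF //; apply: (le_trans (bnd k)).
rewrite -ler_pdivrMr //; near: k; exact: nbhs_infty_ger.
Unshelve. all: by end_near.
Qed.

Lemma powR_young {R : realType} (x y s t : R) : 0 <= x -> 0 <= y ->
  0 < s -> 0 < t -> s + t = 1 -> x `^ s * y `^ t <= s * x + t * y.
Proof.
move=> x0 y0 s0 t0 st.
have := @conjugate_powR R (x `^ s) (y `^ t) s^-1 t^-1.
rewrite !powR_ge0 !invr_gt0 s0 t0 !invrK -!powRrM !mulfV ?gt_eqF //.
by rewrite !powRr1 // ![s * _]mulrC ![t * _]mulrC; apply.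
Qed.

(** Hoelder's inequality for finite sums, from Young's inequality after both sums
are normalised to 1. *)
Lemma sum_powR_hoelder {R : realType} (I : Type) (r : seq I) (f g : I -> R) (s t : R) :
  (forall i, 0 <= f i) -> (forall i, 0 <= g i) ->
  0 < \sum_(i <- r) f i -> 0 < \sum_(i <- r) g i -> 0 < s -> 0 < t -> s + t = 1 ->
  \sum_(i <- r) f i `^ s * g i `^ t <=
  (\sum_(i <- r) f i) `^ s * (\sum_(i <- r) g i) `^ t.
Proof.
move=> f0 g0; set F := \sum_(i <- r) f i; set G := \sum_(i <- r) g i => F0 G0 s0 t0 st.
have FG0 : 0 < F `^ s * G `^ t by rewrite mulr_gt0 ?powR_gt0.
rewrite -[leRHS]mulr1 -ler_pdivrMl // mulr_sumr.
have -> : 1 = \sum_(i <- r) (s * (f i / F) + t * (g i / G)).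
  rewrite big_split /= -!mulr_sumr -!mulr_suml !divff ?gt_eqF //; lra.
apply: ler_sum => i _; apply: le_trans (powR_young _ _ s0 t0 st); last 2 first.
- by rewrite divr_ge0 // ltW.
- by rewrite divr_ge0 // ltW.
rewrite !powRM ?invr_ge0 ?(ltW F0) ?(ltW G0) //.
have invp (X u : R) : 0 < X -> X^-1 `^ u = (X `^ u)^-1.
  by move=> X0; rewrite -powR_inv1 ?ltW // -powRrM mulrC powRrM powR_inv1 // powR_ge0.
by rewrite !invp // invfM le_eqVlt; apply/orP; left; apply/eqP; ring.
Qed.

Lemma expR_small {R : realType} (x e : R) : 0 < x -> 0 < e ->
  exists2 t : R, 0 < t & expR (- (t * x)) <= e.
Proof.
move=> x0 e0; exists (e^-1 / x); first by rewrite divr_gt0 ?invr_gt0.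
rewrite divfK ?gt_eqF // expRN invf_ple ?posrE ?expR_gt0 //.
by apply: le_trans (expR_ge1Dx _); rewrite lerDr.
Qed.

(** Pointwise form of a Paley-Zygmund argument.  With y = expR w and
z = (y expR g)^(-t), the last two terms subtract a multiple of z - k z^2.
The expectation of that expression is bounded below when the first moment of z
is bounded below and its second moment is bounded above.  In return, the mean of
y drops below 1 by a definite amount, up to errors that vanish when v is small
and t and u are large.

If y <= expR (- g / 2), the bound z - k z^2 <= 1 / (4 k) is compensated by the
gap 1 - y, which dictates e.  Otherwise z is at most expR (- t g / 2), and y is
either at most expR v or dominated by the high power y^(u + 1). *)
Lemma expR_le_second_moment {R : realType} (w g t v u k : R) :
  0 < g -> 0 < t -> 0 < v -> 0 < u -> 0 < k ->
  forall e, e = 4 * k * (1 - expR (- (g / 2))) ->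
  expR w <= expR v + expR (- (u * v)) * expR ((u + 1) * w) + e * expR (- (t * (g / 2)))
    - e * (expR (- t * (w + g)) - k * expR (- (2 * t) * (w + g))).
Proof.
move=> g0 t0 v0 u0 k0 e eE.
have g2 : expR (- (g / 2)) < 1 by rewrite expR_lt1; lra.
have e0 : 0 < e by rewrite eE !mulr_gt0 //; lra.
have bigw : 0 < expR (- (u * v)) * expR ((u + 1) * w) by rewrite mulr_gt0 ?expR_gt0.
have ev : 1 < expR v by rewrite expR_gt1.
have eg0 : 0 < e * expR (- (t * (g / 2))) by rewrite mulr_gt0 ?expR_gt0.
set z := expR (- t * (w + g)).
have z0 : 0 < z by exact: expR_gt0.
have -> : expR (- (2 * t) * (w + g)) = z ^+ 2.
  by rewrite expr2 -expRD; congr expR; ring.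
have [wg|wg] := lerP w (- (g / 2)).
  have hw : expR w <= expR (- (g / 2)) by rewrite ler_expR.
  suff : e * (z - k * z ^+ 2) <= 1 - expR (- (g / 2)) by lra.
  rewrite eE mulrAC ler_piMl //; first lra.
  rewrite -subr_ge0 (_ : 1 - _ = (1 - 2 * k * z) ^+ 2); last by ring.
  exact: sqr_ge0.
have hz : z <= expR (- (t * (g / 2))) by rewrite ler_expR; nra.
have ez : e * z <= e * expR (- (t * (g / 2))) by rewrite ler_wpM2l // ltW.
have ekz : 0 <= e * (k * z ^+ 2) by rewrite !mulr_ge0 ?sqr_ge0 // ltW.
suff : expR w <= expR v + expR (- (u * v)) * expR ((u + 1) * w) by lra.
have [wv|wv] := lerP w v.
  have : expR w <= expR v by rewrite ler_expR.
  lra.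
have : expR w <= expR (- (u * v)) * expR ((u + 1) * w) by rewrite -expRD ler_expR; nra.
lra.
Qed.

(** A convex function is differentiable where it has no corner.  Here a and b stand
for the left and right derivatives.  Each is described by the two inequalities
that are used: the supporting line, and the approximation of the slope near q. *)
Lemma convex_derivable {R : realType} (f : R -> R) (q : R) :
  0 < q ->
  (forall x y s t, 0 < x -> 0 < y -> 0 < s -> 0 < t -> s + t = 1 ->
    f (s * x + t * y) <= s * f x + t * f y) ->
  (forall a b, a < b ->
    (forall s, 0 < s -> b * s <= f (q + s) - f q) ->
    (forall s, 0 < s < q -> - a * s <= f (q - s) - f q) ->
    (forall e, 0 < e -> exists2 s1, 0 < s1 & forall s, 0 < s <= s1 ->
       f (q + s) - f q <= (b + e) * s) ->
    (forall e, 0 < e -> exists2 s1, 0 < s1 < q & forall s, 0 < s <= s1 ->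
       f (q - s) - f q <= (e - a) * s) -> False) ->
  derivable f q 1.
Proof.
move=> q0 cvx noncorner.
pose U := [set x | exists2 s, 0 < s & x = (f (q + s) - f q) / s].
pose L := [set x | exists2 s, 0 < s < q & x = (f q - f (q - s)) / s].
have cross s u : 0 < s < q -> 0 < u -> (f q - f (q - s)) / s <= (f (q + u) - f q) / u.
  move=> /andP[s0 sq] u0; have su : 0 < s + u by lra.
  have := cvx (q - s) (q + u) (u / (s + u)) (s / (s + u)).
  rewrite (_ : u / (s + u) + s / (s + u) = 1); last by field; rewrite gt_eqF.
  rewrite !divr_gt0 ?subr_gt0 ?addr_gt0 // => /(_ sq isT isT isT erefl).
  rewrite (_ : u / (s + u) * (q - s) + s / (s + u) * (q + u) = q); last by field; rewrite gt_eqF.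
  rewrite (_ : u / (s + u) * f (q - s) + s / (s + u) * f (q + u) =
    (u * f (q - s) + s * f (q + u)) / (s + u)); last first.
    by field; rewrite gt_eqF.
  rewrite ler_pdivlMr // => h.
  by rewrite ler_pdivrMr // mulrAC ler_pdivlMr //; lra.
have U0 : U !=set0 by exists ((f (q + 1) - f q) / 1), 1.
have L0 : L !=set0.
  by exists ((f q - f (q - q / 2)) / (q / 2)), (q / 2) => //; lra.
have LU x y : L x -> U y -> x <= y by move=> [s s0 ->] [u u0 ->]; exact: cross.
pose a := sup L; pose b := inf U.
have hL : has_sup L.
  by split=> //; case: U0 => y Uy; exists y => x Lx; exact: LU.
have hU : has_inf U.
  by split=> //; case: L0 => x Lx; exists x => y Uy; exact: LU.
have ab : a <= b.
  by apply: sup_le_ub => // x Lx; apply: lb_le_inf => // y Uy; exact: LU.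
have bs s : 0 < s -> b * s <= f (q + s) - f q.
  move=> s0; rewrite -ler_pdivlMr //; apply: ge_inf; first by case: hU.
  by exists s.
have sa s : 0 < s < q -> - a * s <= f (q - s) - f q.
  move=> sq; have /andP[s0 _] := sq.
  suff : (f q - f (q - s)) / s <= a by rewrite ler_pdivrMr //; lra.
  by apply: ub_le_sup; [case: hL | exists s].
have be e : 0 < e -> exists2 s1, 0 < s1 & forall s, 0 < s <= s1 ->
    f (q + s) - f q <= (b + e) * s.
  move=> e0; have [_ [s1 s10 ->] h] := inf_adherent e0 hU.
  exists s1 => // s /andP[s0 ss1]; move: h; rewrite -/b => h.
  have {h} h : f (q + s1) - f q <= (b + e) * s1 by rewrite -ler_pdivrMr // ltW.
  have [->//|ne] := eqVneq s s1; have {ne} ss : s < s1 by rewrite lt_neqAle ne.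
  have := cvx q (q + s1) ((s1 - s) / s1) (s / s1).
  rewrite (_ : (s1 - s) / s1 + s / s1 = 1); last by field; rewrite gt_eqF.
  rewrite !divr_gt0 ?subr_gt0 ?addr_gt0 // => /(_ q0 isT isT isT erefl).
  rewrite (_ : (s1 - s) / s1 * q + s / s1 * (q + s1) = q + s); last by field; rewrite gt_eqF.
  move=> /le_trans; rewrite lerBlDr; apply.
  rewrite (_ : (s1 - s) / s1 * f q + s / s1 * f (q + s1) =
    (f (q + s1) - f q) * (s / s1) + f q); last by field; rewrite gt_eqF.
  rewrite lerD2r (_ : (b + e) * s = (b + e) * s1 * (s / s1)); last by field; rewrite gt_eqF.
  by rewrite ler_wpM2r // divr_ge0 // ltW.
have ae e : 0 < e -> exists2 s1, 0 < s1 < q & forall s, 0 < s <= s1 ->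
    f (q - s) - f q <= (e - a) * s.
  move=> e0; have [_ [s1 s1q ->] h] := sup_adherent e0 hL.
  have /andP[s10 s1q'] := s1q.
  exists s1 => // s /andP[s0 ss1]; move: h; rewrite -/a => h.
  have {h} h : f (q - s1) - f q <= (e - a) * s1.
    by move: h => /ltW; rewrite ler_pdivlMr //; lra.
  have [->//|ne] := eqVneq s s1; have {ne} ss : s < s1 by rewrite lt_neqAle ne.
  have := cvx q (q - s1) ((s1 - s) / s1) (s / s1).
  rewrite (_ : (s1 - s) / s1 + s / s1 = 1); last by field; rewrite gt_eqF.
  rewrite !divr_gt0 ?subr_gt0 ?addr_gt0 // => /(_ q0 s1q' isT isT erefl).
  rewrite (_ : (s1 - s) / s1 * q + s / s1 * (q - s1) = q - s); last by field; rewrite gt_eqF.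
  move=> /le_trans; rewrite lerBlDr; apply.
  rewrite (_ : (s1 - s) / s1 * f q + s / s1 * f (q - s1) =
    (f (q - s1) - f q) * (s / s1) + f q); last by field; rewrite gt_eqF.
  rewrite lerD2r (_ : (e - a) * s = (e - a) * s1 * (s / s1)); last by field; rewrite gt_eqF.
  by rewrite ler_wpM2r // divr_ge0 // ltW.
have {}ab : a = b.
  apply/eqP; rewrite eq_le ab /= leNgt; apply/negP => ab'.
  exact: (noncorner a b).
apply/cvg_ex; exists b; apply/cvgrPdist_le => e e0.
have [s1 s10 h1] := be e e0; have [s2 /andP[s20 s2q] h2] := ae e e0.
near=> h.
have h0 : h != 0 by near: h; exact: nbhs_dnbhs_neq.
have hs : `|h| < Num.min s1 s2.
  near: h; apply: dnbhs0_lt; by rewrite lt_min s10.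
move: hs; rewrite lt_min => /andP[hs1 hs2].
rewrite /= /GRing.scale /= mulr1 [h + q]addrC.
have [hp|hn|h00] := ltrgtP 0 h; last by rewrite -h00 eqxx in h0.
  rewrite gtr0_norm // in hs1.
  have := bs h hp; have := h1 h; rewrite hp ltW // => /(_ isT) hi lo.
  rewrite ler_norml -(ler_pM2r hp) -[X in _ && X](ler_pM2r hp) mulrBl mulrAC mulVf //.
  lra.
rewrite ltr0_norm // in hs2.
have hp : 0 < - h by lra.
have := sa (- h); have := h2 (- h); rewrite hp (ltW hs2) (lt_trans hs2 s2q) opprK ab.
move=> /(_ isT) hi /(_ isT) lo.
rewrite ler_norml -(ler_pM2r hp) -[X in _ && X](ler_pM2r hp) !mulrBl !mulrN mulrAC mulVf //.
lra.
Unshelve. all: by end_near.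
Qed.

(** * Submultiplicative weights with linking words *)

Section LinkedPotential.
Context {R : realType} {T : finType} (phi : seq T -> R).
Hypothesis phi_ge0 : forall J, 0 <= phi J.
Hypothesis phi_cat : forall I J, phi (I ++ J) <= phi I * phi J.
Hypothesis phi_nil_gt0 : 0 < phi [::].
Hypothesis phi_link : exists (r : nat) (c : R), 0 < c /\ forall I J,
  exists2 K, (0 < size K <= r)%N & c * (phi I * phi J) <= phi (I ++ K ++ J).

Lemma phi_bounded r :
  exists2 B : R, 1 <= B & forall J, (size J <= r)%N -> phi J <= B.
Proof.
pose b := 1 + phi [::] + \sum_x phi [:: x].
have S0 : 0 <= \sum_x phi [:: x] by apply: sumr_ge0.
have b1 : 1 <= b by rewrite /b; have := phi_ge0 [::]; lra.
have b0 : 0 <= b by lra.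
exists (b ^+ r.+1); first exact: exprn_ege1.
move=> J sJ; apply: (@le_trans _ _ (b ^+ (size J).+1)); last exact: ler_weXn2l.
elim: J {sJ} => [|x J IH]; first by rewrite expr1 /b; lra.
rewrite exprS (le_trans (phi_cat [:: x] J)) // ler_pM //.
rewrite /b (bigD1 x) //=; have : 0 <= \sum_(y | y != x) phi [:: y] by apply: sumr_ge0.
have := phi_ge0 [::]; lra.
Qed.

(** Linking I to the empty word extends I by a bounded number of letters at a
bounded cost; submultiplicativity then bounds the cost of the first of these
letters alone. *)
Lemma extend_right : exists2 c : R, 0 < c <= 1 & forall n I,
  exists2 E, size E = n & c ^+ n * phi I <= phi (I ++ E).
Proof.
have [r [c [c0 link]]] := phi_link.
have [B B1 phiB] := phi_bounded r.
pose c1 := Num.min 1 (c * phi [::] / B).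
have c10 : 0 < c1 by rewrite lt_min ltr01 divr_gt0 ?mulr_gt0 //; lra.
exists c1; first by rewrite c10 ge_min lexx.
elim=> [|n IH] I; first by exists [::]; rewrite // expr0 mul1r cats0.
have [[|x K] //= sK] := link I [::]; rewrite cats0 => hK.
have [E sE hE] := IH (I ++ [:: x]).
exists (x :: E); first by rewrite /= sE.
rewrite -cat1s catA; apply: le_trans hE.
rewrite exprSr -mulrA ler_wpM2l ?exprn_ge0 ?(ltW c10) //.
apply: (@le_trans _ _ (c * phi [::] / B * phi I)).
  by rewrite ler_wpM2r // /c1 ge_min lexx orbT.
rewrite mulrAC ler_pdivrMr; last lra.
have := phi_cat (I ++ [:: x]) K; rewrite -catA cat1s => hc.
have := phiB K; rewrite (ltnW sK) => /(_ isT) => hB.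
have : phi (I ++ [:: x]) * phi K <= phi (I ++ [:: x]) * B by rewrite ler_wpM2l.
move: hK; rewrite (mulrC (phi I)) mulrA; lra.
Qed.

(** Linking words have variable length; appending letters to J brings the total
padding to a fixed length r, so that the sums over J stay comparable. *)
Lemma link_padded : exists (r : nat) (c : R), 0 < c <= 1 /\ forall I J, exists K E,
  (size K + size E)%N = r /\ c * (phi I * phi J) <= phi (I ++ K ++ J ++ E).
Proof.
have [r [c [c0 link]]] := phi_link.
have [c1 /andP[c10 c11] ext] := extend_right.
pose c2 := Num.min 1 (c * c1 ^+ r).
have c20 : 0 < c2 by rewrite lt_min ltr01 mulr_gt0 // exprn_gt0.
exists r, c2; split; first by rewrite c20 ge_min lexx.
move=> I J; have [K /andP[_ sK] hK] := link I J.
have [E sE hE] := ext (r - size K)%N (I ++ K ++ J).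
exists K, E; split; first by lia.
rewrite -!catA in hE; apply: le_trans hE.
have X0 : 0 <= phi I * phi J by rewrite mulr_ge0.
apply: (@le_trans _ _ (c * c1 ^+ r * (phi I * phi J))).
  by rewrite ler_wpM2r // /c2 ge_min lexx orbT.
rewrite mulrAC mulrC; apply: ler_pM => //; first exact/exprn_ge0/ltW.
  by rewrite mulr_ge0 // ltW.
by apply: ler_wiXn2l; rewrite ?(ltW c10) //; exact: leq_subr.
Qed.

(** The case I = [::] is the usual partition function.  Keeping the prefix I
gives finite-volume versions of the Gibbs weights of cylinders. *)
Definition partition_sum (q : R) (n : nat) (I : seq T) : R :=
  \sum_(L <- all_words n) phi (I ++ L) `^ q.

Local Notation Z := partition_sum.

Lemma partition_sum_ge0 q n I : 0 <= Z q n I.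
Proof. by apply: sumr_ge0 => J _; apply: powR_ge0. Qed.

Lemma partition_sum_cat q n l I : Z q (n + l) I = \sum_(J <- all_words n) Z q l (I ++ J).
Proof.
rewrite /partition_sum big_all_words_cat; apply: eq_bigr => J _.
by apply: eq_bigr => L _; rewrite catA.
Qed.

Lemma phi_cat_powR q I J : 0 < q -> phi (I ++ J) `^ q <= phi I `^ q * phi J `^ q.
Proof. by move=> q0; rewrite -powRM //; apply: powR_le_base => //; apply: ltW. Qed.

Lemma partition_sum_le q n I : 0 < q -> Z q n I <= phi I `^ q * Z q n [::].
Proof.
move=> q0; rewrite mulr_sumr; apply: ler_sum => L _; exact: phi_cat_powR.
Qed.

Lemma partition_sum_submul q n l I : 0 < q -> Z q (n + l) I <= Z q n I * Z q l [::].
Proof.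
move=> q0; rewrite partition_sum_cat mulr_suml; apply: ler_sum => J _; exact: partition_sum_le.
Qed.

Lemma partition_sum_gt0 q n : 0 < Z q n [::].
Proof.
have [c /andP[c0 _] ext] := extend_right; have [E sE hE] := ext n [::].
have : 0 < phi E by apply: lt_le_trans hE; rewrite mulr_gt0 // exprn_gt0.
move=> /(@powR_gt0 _ _ q) /lt_le_trans; apply.
by apply: (@sum_words_ge _ _ _ (fun L => phi L `^ q)) => // K; exact: powR_ge0.
Qed.

#[local] Hint Resolve partition_sum_gt0 : core.

Lemma partition_sum_bounded Q n :
  exists2 D : R, 1 <= D & forall q, 0 < q <= Q -> Z q n [::] <= D.
Proof.
have [B B1 phiB] := phi_bounded n.
exists (1 + \sum_(L <- @all_words T n) B `^ Q).
  by rewrite lerDl sumr_ge0 // => ? _; exact: powR_ge0.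
move=> q /andP[q0 qQ]; rewrite -[leLHS]add0r lerD //; apply: ler_sum_words => J sJ.
apply: (@le_trans _ _ (B `^ q)); last exact: ler_powR.
by apply: powR_le_base; rewrite ?phiB ?sJ // ltW.
Qed.

(** The source of all lower bounds.  Each J extends to a word L = K ++ J ++ E for
which phi (I ++ L) is comparable from below to phi I * phi J.  As phi L is at
most a constant times phi J, the factor phi L `^ (- t) is not lost either. *)
Lemma neg_moment_padded (Q : R) : exists (r : nat) (c : R), 0 < c <= 1 /\
  forall (q t : R) I n, 0 <= t -> t < q -> q <= Q ->
  c * phi I `^ q * Z (q - t) n [::] <=
  \sum_(L <- all_words (n + r)) phi (I ++ L) `^ q * phi L `^ (- t).
Proof.
have [r [k [/andP[k0 k1] link]]] := link_padded.
have [B B1 phiB] := phi_bounded r.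
have BB1 : 1 <= B * B by nra.
have r0 : 0 < r.+1%:R^-1 :> R by rewrite invr_gt0.
exists r, (r.+1%:R^-1 * Num.min 1 (k `^ Q * (B * B) `^ (- Q))); split.
  apply/andP; split.
    by rewrite mulr_gt0 // lt_min ltr01 mulr_gt0 // powR_gt0 //; lra.
  by rewrite mulr_ile1 ?(ltW r0) ?ge_min ?lexx //=
     ?invf_le1 ?ler1n // le_min ler01 mulr_ge0 ?powR_ge0.
move=> q t I n t0 tq qQ; rewrite -!mulrA ler_pdivrMl ?ltr0n //.
rewrite /partition_sum !mulr_sumr -[leRHS]mulr_sumr.
apply: (sum_words_padding (H := fun L => phi (I ++ L) `^ q * phi L `^ (- t))).
  by move=> L; rewrite mulr_ge0 ?powR_ge0.
move=> J _; have [K [E [sKE hKE]]] := link I J.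
exists K, E; split=> //.
have rhs0 : 0 <= phi (I ++ K ++ J ++ E) `^ q * phi (K ++ J ++ E) `^ (- t).
  by rewrite mulr_ge0 ?powR_ge0.
have [I0|I0] := eqVneq (phi I) 0.
  by rewrite I0 powR0 ?mul0r ?mulr0 //; lra.
have [J0|J0] := eqVneq (phi J) 0.
  by rewrite J0 powR0 ?mulr0 //; lra.
have Ip : 0 < phi I by rewrite lt0r I0 phi_ge0.
have Jp : 0 < phi J by rewrite lt0r J0 phi_ge0.
have kp : 0 < k * (phi I * phi J) by rewrite !mulr_gt0.
have Lp : 0 < phi (K ++ J ++ E).
  rewrite lt0r phi_ge0 andbT; apply/eqP => L0.
  by have := phi_cat I (K ++ J ++ E); rewrite L0 mulr0; lra.
have LB : phi (K ++ J ++ E) <= (B * B) * phi J.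
  apply: (le_trans (phi_cat _ _)).
  have -> : B * B * phi J = B * (phi J * B) by ring.
  apply: ler_pM; [exact: phi_ge0 | exact: phi_ge0 | |].
    by apply: phiB; rewrite -sKE leq_addr.
  apply: (le_trans (phi_cat _ _)); apply: ler_wpM2l; first exact: phi_ge0.
  by apply: phiB; rewrite -sKE leq_addl.
have h1 : k `^ Q * (phi I `^ q * phi J `^ q) <= phi (I ++ K ++ J ++ E) `^ q.
  apply: (@le_trans _ _ ((k * (phi I * phi J)) `^ q)).
    rewrite !powRM ?mulr_ge0 ?phi_ge0 ?(ltW k0) // ler_wpM2r ?mulr_ge0 ?powR_ge0 //.
    by apply: ger_powR => //; rewrite k0.
  by apply: powR_le_base; lra.
have h2 : (B * B) `^ (- Q) * phi J `^ (- t) <= phi (K ++ J ++ E) `^ (- t).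
  apply: (@le_trans _ _ ((B * B * phi J) `^ (- t))).
    rewrite [leRHS]powRM ?phi_ge0 //; last by lra.
    by rewrite ler_wpM2r ?powR_ge0 // ler_powR //; lra.
  rewrite !powRN lef_pV2 ?posrE ?powR_gt0 //; last by rewrite mulr_gt0 //; lra.
  by apply: powR_le_base => //; exact: ltW.
apply: le_trans (ler_pM _ _ h1 h2); rewrite ?mulr_ge0 ?powR_ge0 //.
rewrite powRD; last by rewrite J0 implybT.
have -> : k `^ Q * (phi I `^ q * phi J `^ q) * ((B * B) `^ (- Q) * phi J `^ (- t)) =
  (k `^ Q * (B * B) `^ (- Q)) * (phi I `^ q * (phi J `^ q * phi J `^ (- t))) by ring.
by rewrite ler_wpM2r ?mulr_ge0 ?powR_ge0 // ge_min lexx orbT.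
Qed.

Lemma neg_moment_ge (Q : R) : exists (r : nat) (c : R), 0 < c <= 1 /\
  forall (q t : R) I n, (r <= n)%N -> 0 <= t -> t < q -> q <= Q ->
  c * phi I `^ q * Z (q - t) n [::] <=
  \sum_(L <- all_words n) phi (I ++ L) `^ q * phi L `^ (- t).
Proof.
have [r [c [/andP[c0 c1] low]]] := neg_moment_padded Q.
have [D D1 ZD] := partition_sum_bounded Q r.
have D0 : 0 < D by lra.
exists r, (c / D); split.
  by rewrite divr_gt0 //= ler_pdivrMr //; lra.
move=> q t I n rn t0 tq qQ.
have := low q t I (n - r)%N t0 tq qQ; rewrite subnK //; apply: le_trans.
have qt0 : 0 < q - t by lra.
rewrite -!mulrA ler_wpM2l ?(ltW c0) // mulrCA ler_wpM2l ?powR_ge0 //.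
rewrite mulrC ler_pdivrMr //.
have := partition_sum_submul (n - r) r [::] qt0; rewrite subnK // => /le_trans; apply.
by rewrite ler_wpM2l ?partition_sum_ge0 // ZD //; lra.
Qed.

(** The converse of [partition_sum_le]: what follows I is, up to a constant,
independent of I.  The constant is uniform for q in a bounded range, which is
what allows exponents q + t / n to be compared with q. *)
Lemma partition_sum_ge (Q : R) : exists2 c : R, 0 < c <= 1 & forall q I n, 0 < q <= Q ->
  c * phi I `^ q * Z q n [::] <= Z q n I.
Proof.
have [r [c [/andP[c0 c1] low]]] := neg_moment_padded Q.
have [D D1 ZD] := partition_sum_bounded Q r.
have D0 : 0 < D by lra.
exists (c / D); first by rewrite divr_gt0 //= ler_pdivrMr //; lra.
move=> q I n /andP[q0 qQ].
rewrite -2!mulrA [_^-1 * _]mulrC !mulrA ler_pdivrMr //.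
have := low q 0 I n (lexx _) q0 qQ; rewrite subr0 => /le_trans; apply.
rewrite (_ : \sum_(_ <- _) _ = Z q (n + r) I); last first.
  by apply: eq_bigr => L _; rewrite oppr0 powRr0 mulr1.
by apply: (le_trans (partition_sum_submul _ _ _ q0)); rewrite ler_wpM2l ?partition_sum_ge0 // ZD // q0.
Qed.

Lemma partition_sum_supmul (Q : R) : exists2 c : R, 0 < c <= 1 & forall q n l, 0 < q <= Q ->
  c * Z q n [::] * Z q l [::] <= Z q (n + l) [::].
Proof.
have [c c01 low] := partition_sum_ge Q; exists c => // q n l qQ.
rewrite partition_sum_cat -mulrA mulrCA mulr_suml; apply: ler_sum => J _.
by rewrite mulrCA mulrA; exact: low.
Qed.

Definition word_pressure (q : R) : R := lim (n%:R^-1 * ln (Z q n [::]) @[n --> \oo]).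

Lemma ln_partition_sum_pressure (Q : R) : exists C : R, forall q n, 0 < q <= Q ->
  `|ln (Z q n [::]) - n%:R * word_pressure q| <= C.
Proof.
have [c /andP[c0 c1] sup] := partition_sum_supmul Q.
exists (- ln c) => q n qQ; have /andP[q0 _] := qQ.
apply: (@near_additive_limit _ (fun n => ln (Z q n [::]))) => {}n l.
have c_le0 : ln c <= 0 by rewrite -ln1 ler_ln ?posrE.
have up : ln (Z q (n + l) [::]) <= ln (Z q n [::]) + ln (Z q l [::]).
  by rewrite -lnM ?posrE // ler_ln ?posrE ?mulr_gt0 //; exact: partition_sum_submul.
have lo : ln c + (ln (Z q n [::]) + ln (Z q l [::])) <= ln (Z q (n + l) [::]).
  rewrite -!lnM ?posrE ?mulr_gt0 // ler_ln ?posrE ?mulr_gt0 // mulrA; exact: sup.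
by rewrite ler_norml; lra.
Qed.

(** Hoelder's inequality makes ln (Z q n [::]) convex in q; the bounded error
disappears after division by n. *)
Lemma word_pressure_convex x y s t : 0 < x -> 0 < y -> 0 < s -> 0 < t -> s + t = 1 ->
  word_pressure (s * x + t * y) <= s * word_pressure x + t * word_pressure y.
Proof.
move=> x0 y0 s0 t0 st.
have [C hC] := ln_partition_sum_pressure (Num.max x y).
have sy : s * x <= s * Num.max x y by rewrite ler_pM2l // le_max lexx.
have ty : t * y <= t * Num.max x y by rewrite ler_pM2l // le_max lexx orbT.
have sx0 : 0 < s * x by rewrite mulr_gt0.
have ty0 : 0 < t * y by rewrite mulr_gt0.
have mix : s * x + t * y <= Num.max x y.
  have -> : Num.max x y = s * Num.max x y + t * Num.max x y by rewrite -mulrDl st mul1r.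
  lra.
rewrite -subr_le0; apply: (@bounded_multiples_le0 _ _ (2 * C)) => n.
have Zc : ln (Z (s * x + t * y) n [::]) <= s * ln (Z x n [::]) + t * ln (Z y n [::]).
  rewrite -!ln_powR -lnM ?posrE ?powR_gt0 // ler_ln ?posrE ?mulr_gt0 ?powR_gt0 //.
  apply: le_trans (sum_powR_hoelder _ _ (partition_sum_gt0 x n) (partition_sum_gt0 y n) s0 t0 st); last 2 first.
  - by move=> L; exact: powR_ge0.
  - by move=> L; exact: powR_ge0.
  apply: ler_sum => L _; rewrite -!powRrM ![_ * s]mulrC ![_ * t]mulrC -powRD //.
  by rewrite gt_eqF //; lra.
have := hC (s * x + t * y) n; have := hC x n; have := hC y n.
rewrite mix x0 y0 !le_max !lexx orbT addr_gt0 //= => /(_ isT) hy /(_ isT) hx /(_ isT).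
move: hx hy; rewrite !ler_norml => /andP[_ hx] /andP[_ hy] /andP[hm _].
have sh : s * (ln (Z x n [::]) - n%:R * word_pressure x) <= s * C by rewrite ler_pM2l.
have th : t * (ln (Z y n [::]) - n%:R * word_pressure y) <= t * C by rewrite ler_pM2l.
have stC : s * C + t * C = C by rewrite -mulrDl st mul1r.
move: sh th hm Zc stC; lra.
Qed.

(** Words of weight zero contribute nothing, so powers of phi J may be written as
exponentials, for which the exponent can be manipulated freely. *)
Lemma partition_sum_weight_powR q t l I J : 0 < q ->
  Z q l (I ++ J) * expR (t * ln (phi J)) = Z q l (I ++ J) * phi J `^ t.
Proof.
move=> q0; have [J0|J0] := eqVneq (phi J) 0; last by rewrite /powR (negbTE J0).
suff -> : Z q l (I ++ J) = 0 by rewrite !mul0r.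
apply/eqP; rewrite eq_le partition_sum_ge0 andbT.
have IJ0 : phi (I ++ J) = 0.
  by apply/eqP; rewrite eq_le phi_ge0 andbT (le_trans (phi_cat I J)) // J0 mulr0.
by apply: le_trans (partition_sum_le _ _ q0) _; rewrite IJ0 powR0 ?mul0r ?gt_eqF.
Qed.

(** Moments of phi J under the conditional law pi of the block J of length n that
follows the prefix I, both sides being multiplied by Z q (n + l) I.  The upper
bound holds because pi is dominated by a multiple of the law with weights
phi J `^ q.  The reverse domination fails, because J may be a bad continuation of I, and linking
words replace it; they need room, hence the condition r <= n. *)
Lemma conditional_moments (q : R) : 0 < q -> exists (r : nat) (k : R), 0 < k <= 1 /\
  (forall t n l I, - q < t -> t <= q ->
    k * \sum_(J <- all_words n) Z q l (I ++ J) * expR (t * ln (phi J)) <=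
    expR (n%:R * (word_pressure (q + t) - word_pressure q)) * Z q (n + l) I) /\
  (forall t n l I, (r <= n)%N -> 0 <= t -> t < q ->
    k * expR (n%:R * (word_pressure (q - t) - word_pressure q)) * Z q (n + l) I <=
    \sum_(J <- all_words n) Z q l (I ++ J) * expR (- t * ln (phi J))).
Proof.
move=> q0.
have [c1 /andP[c10 c11] Zge] := partition_sum_ge (2 * q).
have [c2 /andP[c20 c21] Zsup] := partition_sum_supmul (2 * q).
have [r [c3 [/andP[c30 c31] low]]] :=
  neg_moment_ge (2 * q).
have [C hC] := ln_partition_sum_pressure (2 * q).
have C0 : 0 <= C by apply: le_trans (hC q 0%N _) => //; lra.
have ZP t n : 0 < q + t <= 2 * q ->
    expR (n%:R * (word_pressure (q + t) - word_pressure q) - 2 * C) * Z q n [::] <= Z (q + t) n [::]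
    /\ Z (q + t) n [::] <=
       expR (n%:R * (word_pressure (q + t) - word_pressure q) + 2 * C) * Z q n [::].
  move=> qt; have := hC _ n qt; have := hC q n; rewrite q0 /= => /(_ ltac:(lra)).
  rewrite !ler_norml => /andP[h1 h2] /andP[h3 h4].
  have lnK' (x : R) : 0 < x -> x = expR (ln x) by move=> x0; rewrite lnK ?posrE.
  rewrite (lnK' _ (partition_sum_gt0 q n)) (lnK' _ (partition_sum_gt0 (q + t) n)).
  by rewrite -!expRD !ler_expR; split; lra.
have unitM (x y : R) : 0 < x <= 1 -> 0 < y <= 1 -> 0 < x * y <= 1.
  by move=> /andP[x0 x1] /andP[y0 y1]; rewrite mulr_gt0 //= mulr_ile1 // ltW.
pose k := c1 * c2 * c3 * expR (- (2 * C)).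
have e0 := expR_gt0 (- (2 * C)).
have e1 : expR (- (2 * C)) <= 1 by rewrite expR_le1; lra.
exists r, k; split; last split.
- by apply: unitM (unitM _ _ (unitM _ _ _ _) _) _; apply/andP.
- move=> t n l I tq1 tq2; under eq_bigr do rewrite partition_sum_weight_powR //.
  have [_ hi] := ZP t n ltac:(lra).
  have S1 : \sum_(J <- all_words n) Z q l (I ++ J) * phi J `^ t <=
      phi I `^ q * Z q l [::] * Z (q + t) n [::].
    rewrite mulr_sumr; apply: ler_sum => J _ /=.
    rewrite powRD; last by rewrite gt_eqF //; lra.
    rewrite (mulrA _ _ (phi J `^ t)) ler_wpM2r ?powR_ge0 //.
    apply: (le_trans (partition_sum_le _ _ q0)).
    rewrite mulrAC ler_wpM2r ?partition_sum_ge0 //; exact: phi_cat_powR.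
  have S2 : c1 * c2 * (phi I `^ q * Z q l [::] * Z q n [::]) <= Z q (n + l) I.
    apply: le_trans (Zge q I (n + l)%N _); last by lra.
    rewrite -mulrA -[leRHS]mulrA ler_wpM2l ?(ltW c10) //.
    have -> : c2 * (phi I `^ q * Z q l [::] * Z q n [::]) =
      phi I `^ q * (c2 * Z q n [::] * Z q l [::]) by ring.
    by rewrite ler_wpM2l ?powR_ge0 // Zsup //; lra.
  apply: (@le_trans _ _ (c1 * c2 * expR (- (2 * C)) *
      (phi I `^ q * Z q l [::] * Z (q + t) n [::]))).
    apply: ler_pM => //; rewrite ?mulr_ge0 ?(ltW c10) ?(ltW c20) ?(ltW c30) ?(ltW e0) //.
      by apply: sumr_ge0 => J _; rewrite mulr_ge0 ?partition_sum_ge0 ?powR_ge0.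
    by rewrite /k ler_wpM2r ?(ltW e0) // ler_piMr // mulr_ge0 ?(ltW c10) ?(ltW c20).
  apply: (@le_trans _ _ (c1 * c2 * expR (- (2 * C)) *
      (phi I `^ q * Z q l [::] *
       (expR (n%:R * (word_pressure (q + t) - word_pressure q) + 2 * C) * Z q n [::])))).
    rewrite ler_wpM2l ?mulr_ge0 ?(ltW c10) ?(ltW c20) ?(ltW e0) //.
    by rewrite ler_wpM2l ?mulr_ge0 ?powR_ge0 ?partition_sum_ge0.
  rewrite [expR (_ + _)]expRD.
  have eC : expR (- (2 * C)) * expR (2 * C) = 1 by rewrite -expRD addNr expR0.
  set E := expR (n%:R * _).
  rewrite (_ : _ * _ = (expR (- (2 * C)) * expR (2 * C)) *
    (E * (c1 * c2 * (phi I `^ q * Z q l [::] * Z q n [::])))); last by ring.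
  by rewrite eC mul1r ler_wpM2l ?expR_ge0.
- move=> t n l I rn t0 tq; under eq_bigr do rewrite partition_sum_weight_powR //.
  have [lo _] := ZP (- t) n ltac:(lra).
  have S1 : c1 * Z q l [::] * (c3 * phi I `^ q * Z (q - t) n [::]) <=
      \sum_(J <- all_words n) Z q l (I ++ J) * phi J `^ (- t).
    apply: (@le_trans _ _ (c1 * Z q l [::] *
       \sum_(J <- all_words n) phi (I ++ J) `^ q * phi J `^ (- t))).
      by rewrite ler_wpM2l ?mulr_ge0 ?partition_sum_ge0 ?(ltW c10) // low //; lra.
    rewrite mulr_sumr; apply: ler_sum => J _; rewrite mulrA ler_wpM2r ?powR_ge0 //.
    by rewrite mulrAC Zge //; lra.
  apply: le_trans S1.
  have S2 : Z q (n + l) I <= phi I `^ q * (Z q n [::] * Z q l [::]).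
    apply: (le_trans (partition_sum_le _ _ q0)); rewrite ler_wpM2l ?powR_ge0 //.
    exact: partition_sum_submul.
  set E := expR (n%:R * _).
  have E0 : 0 <= E by exact: expR_ge0.
  have {}lo : expR (- (2 * C)) * E * Z q n [::] <= Z (q - t) n [::].
    by rewrite (mulrC (expR _)) -expRD; exact: lo.
  apply: (@le_trans _ _ (k * E * (phi I `^ q * (Z q n [::] * Z q l [::])))).
    by rewrite ler_wpM2l // /k !mulr_ge0 // ltW.
  rewrite (_ : k * E * _ = (c1 * c3 * phi I `^ q * Z q l [::]) *
    (c2 * (expR (- (2 * C)) * E * Z q n [::]))); last by rewrite /k; ring.
  rewrite (_ : c1 * Z q l [::] * _ = (c1 * c3 * phi I `^ q * Z q l [::]) *
    Z (q - t) n [::]); last by ring.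
  rewrite ler_wpM2l ?mulr_ge0 ?powR_ge0 ?partition_sum_ge0 ?(ltW c10) ?(ltW c30) //.
  apply: le_trans lo; rewrite ler_piMl // !mulr_ge0 ?partition_sum_ge0 //; exact: ltW.
Qed.

(** Chaining the bound over N consecutive blocks, each conditioned on all the
previous ones, gives Z (q + d) (N n) [::] <= lam^N Z q (N n) [::] up to a
constant, by submultiplicativity of phi. *)
Lemma pressure_slope_le_of_block_bound (q d lam : R) (n : nat) : 0 < q -> 0 <= d -> 0 < lam ->
  (forall I l, \sum_(J <- all_words n) Z q l (I ++ J) * expR (d * ln (phi J)) <=
    lam * Z q (n + l) I) ->
  n%:R * (word_pressure (q + d) - word_pressure q) <= ln lam.
Proof.
move=> q0 d0 lam0 block.
have iter N I : \sum_(L <- all_words (N * n)) phi (I ++ L) `^ q * phi L `^ d <=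
    lam ^+ N * phi [::] `^ d * Z q (N * n) I.
  elim: N I => [|N IH] I.
    by rewrite mul0n expr0 mul1r /partition_sum /= !big_seq1 cats0 mulrC.
  rewrite mulSn big_all_words_cat.
  apply: (@le_trans _ _ (\sum_(J <- all_words n) (lam ^+ N * phi [::] `^ d) *
      (Z q (N * n) (I ++ J) * expR (d * ln (phi J))))).
    apply: ler_sum => J _; rewrite partition_sum_weight_powR // mulrA.
    apply: le_trans (ler_wpM2r (powR_ge0 _ _) (IH (I ++ J))).
    rewrite mulr_suml; apply: ler_sum => L _.
    rewrite catA -mulrA ler_wpM2l ?powR_ge0 // mulrC -powRM //.
    exact: powR_le_base.
  rewrite -mulr_sumr.
  have -> : lam ^+ N.+1 * phi [::] `^ d * Z q (n + N * n) I =
      lam ^+ N * phi [::] `^ d * (lam * Z q (n + N * n) I) by rewrite exprSr; ring.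
  by rewrite ler_wpM2l // mulr_ge0 ?powR_ge0 ?exprn_ge0 // ltW.
have [C hC] := ln_partition_sum_pressure (q + d).
have p0 : 0 < phi [::] `^ d by rewrite powR_gt0.
have growth N m : Z (q + d) m [::] <= lam ^+ N * phi [::] `^ d * Z q m [::] ->
    m%:R * (word_pressure (q + d) - word_pressure q) <= N%:R * ln lam + ln (phi [::] `^ d) + 2 * C.
  have lN : 0 < lam ^+ N by rewrite exprn_gt0.
  rewrite -ler_ln ?posrE ?mulr_gt0 // !lnM ?posrE ?mulr_gt0 // lnXn // -mulr_natl.
  have h1 : 0 < q <= q + d by rewrite q0 lerDl.
  have h2 : 0 < q + d <= q + d by rewrite lexx andbT ltr_wpDr.
  have /ler_normlP[_ h3] := hC _ m h1; have /ler_normlP[h4 _] := hC _ m h2.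
  move: h3 h4.
  move: (ln (Z (q + d) m [::])) (ln (Z q m [::])) (ln (phi [::] `^ d)) (ln lam).
  move: (word_pressure (q + d)) (word_pressure q) => {h1 h2 lN iter block hC} P1 P0 z1 z0 y x; lra.
rewrite -subr_le0; apply: (@bounded_multiples_le0 _ _ (ln (phi [::] `^ d) + 2 * C)) => N.
rewrite mulrBr lerBlDl addrA mulrA -natrM; apply: growth.
apply: le_trans (iter N [::]); apply: ler_sum => L _ /=.
by rewrite powRD // gt_eqF //; lra.
Qed.

(** If the left derivative a of the pressure is smaller than the right derivative b,
then a definite proportion of the blocks J of length n following any prefix
have phi J ^ (1 / n) at most expR ((a + b) / 2), while values well above expR b
are negligible.  So the conditional mean of phi J ^ (1 / n) is smaller than expR b
by a factor that depends neither on the prefix nor on what comes after. *)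
Lemma corner_block_bound (q a b : R) : 0 < q -> a < b ->
  (forall s, 0 < s < q -> - a * s <= word_pressure (q - s) - word_pressure q) ->
  (forall e, 0 < e -> exists2 s1, 0 < s1 & forall s, 0 < s <= s1 ->
     word_pressure (q + s) - word_pressure q <= (b + e) * s) ->
  (forall e, 0 < e -> exists2 s1, 0 < s1 < q & forall s, 0 < s <= s1 ->
     word_pressure (q - s) - word_pressure q <= (e - a) * s) ->
  exists (eta : R) (n : nat), [/\ 0 < eta, (0 < n)%N &
    forall I l, \sum_(J <- all_words n) Z q l (I ++ J) * expR (n%:R^-1 * ln (phi J)) <=
      expR (b - eta) * Z q (n + l) I].
Proof.
move=> q0 ab lowa upb upa.
have [r [k [/andP[k0 k1] [upm lowm]]]] :=
  conditional_moments q0.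
pose g := b - a; have g0 : 0 < g by rewrite subr_gt0.
pose M := expR 1 / k; have M0 : 0 < M by rewrite divr_gt0 ?expR_gt0.
(* The moments of z of orders 1 and 2 are at least k and at most M; this kap
   makes the mean of z - kap z^2 at least k / 2. *)
(* The parameters t, v, u below make each of the three error terms at most eta,
   while the gain e * (k / 2) is 4 * eta. *)
pose kap := k / (2 * M); have kap0 : 0 < kap by rewrite divr_gt0 // mulr_gt0.
pose e := 4 * kap * (1 - expR (- (g / 2))).
have g2 : expR (- (g / 2)) < 1 by rewrite expR_lt1; lra.
have e0 : 0 < e by rewrite /e mulr_gt0 ?subr_gt0 // mulr_gt0.
pose eta := e * k / 8; have eta0 : 0 < eta by rewrite /eta divr_gt0 // mulr_gt0.
have [t t0 ht] := @expR_small R (g / 2) (k / 8) ltac:(lra) ltac:(lra).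
pose v := ln (1 + eta); have v0 : 0 < v by rewrite ln_gt0 //; lra.
have vE : expR v = 1 + eta by rewrite lnK // posrE; lra.
have [u u0 hu] := @expR_small R v (eta / M) v0 (divr_gt0 eta0 M0).
have [s1 s10 up1] := upb (u + 1)^-1 ltac:(rewrite invr_gt0; lra).
have [s2 /andP[s20 s2q] up2] := upa (2 * t)^-1 ltac:(rewrite invr_gt0; lra).
(* The block length n makes the increments (u + 1) / n and 2 t / n so small that
   the pressure is linear there up to an error 1 / n. *)
pose X := (u + 1) / s1 + (u + 1) / q + 2 * t / s2.
have x1 : 0 < (u + 1) / s1 by rewrite divr_gt0 //; lra.
have x2 : 0 < (u + 1) / q by rewrite divr_gt0 //; lra.
have x3 : 0 < 2 * t / s2 by rewrite divr_gt0 // mulr_gt0.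
pose n := (r.+1 + Num.bound X)%N.
have nX : X < n%:R.
  have : X < (Num.bound X)%:R by apply: archi_boundP; rewrite /X; lra.
  by move=> /lt_le_trans; apply; rewrite ler_nat leq_addl.
have n0 : 0 < n%:R :> R by rewrite ltr0n.
have nN0 : n%:R != 0 :> R by rewrite gt_eqF.
have le1 : (u + 1) / n%:R <= s1.
  by rewrite ler_pdivrMr // mulrC -ler_pdivrMr //; move: nX; rewrite /X; lra.
have le2 : (u + 1) / n%:R <= q.
  by rewrite ler_pdivrMr // mulrC -ler_pdivrMr //; move: nX; rewrite /X; lra.
have le3 : 2 * t / n%:R <= s2.
  by rewrite ler_pdivrMr // [leRHS]mulrC -ler_pdivrMr //; move: nX; rewrite /X; lra.
have tn0 : 0 < t / n%:R by rewrite divr_gt0.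
have un0 : 0 < (u + 1) / n%:R by rewrite divr_gt0 //; lra.
have tnE : 2 * t / n%:R = 2 * (t / n%:R) by rewrite mulrA.
have unq : - q < (u + 1) / n%:R by apply: lt_trans un0; rewrite oppr_lt0.
have tnq : - q < - (2 * t / n%:R) by rewrite ltrN2 (le_lt_trans le3).
have tnq' : - (2 * t / n%:R) <= q by apply: ltW; apply: lt_trans q0; rewrite oppr_lt0 divr_gt0 // mulr_gt0.
exists eta, n; split => // I l.
set H := Z q (n + l) I.
have H0 : 0 <= H by exact: partition_sum_ge0.
pose w J := n%:R^-1 * ln (phi J) - b.
pose S (f : seq T -> R) := \sum_(J <- all_words n) Z q l (I ++ J) * expR (f J).
have Sshift f c h : (forall J, f J = c + h J) -> S f = expR c * S h.
  move=> fE; rewrite /S mulr_sumr; apply: eq_bigr => J _.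
  by rewrite fE expRD mulrCA.
(* The exponents in the next three claims are those of y^(u + 1), z and z^2,
   with y = expR (w J) and z = (y expR g)^(-t). *)
have Sy : S (fun J => (u + 1) * w J) <= M * H.
  rewrite /M mulrAC ler_pdivlMr // mulrC.
  rewrite (Sshift _ (- ((u + 1) * b)) (fun J => (u + 1) / n%:R * ln (phi J))); last first.
    by move=> J; rewrite /w; ring.
  have /(ler_wpM2l (expR_ge0 (- ((u + 1) * b)))) := upm ((u + 1) / n%:R) n l I unq le2.
  rewrite mulrCA => /le_trans; apply; rewrite mulrA -expRD ler_wpM2r // ler_expR.
  have := up1 ((u + 1) / n%:R); rewrite un0 le1 => /(_ isT).
  move/(ler_wpM2l (ltW n0)).
  rewrite (_ : n%:R * ((b + _) * _) = (u + 1) * b + 1).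
    by move: (n%:R * _) => y; lra.
  by field; rewrite nN0 gt_eqF //; lra.
have Sz : k * H <= S (fun J => - t * (w J + g)).
  rewrite (Sshift _ (t * a) (fun J => - (t / n%:R) * ln (phi J))); last first.
    by move=> J; rewrite /w /g; ring.
  have tq : t / n%:R < q by lra.
  have rn : (r <= n)%N by exact: leq_trans (leqnSn r) (leq_addr _ _).
  have /(ler_wpM2l (expR_ge0 (t * a))) := lowm (t / n%:R) n l I rn (ltW tn0) tq.
  apply: le_trans; set E := expR (n%:R * _).
  have -> : expR (t * a) * (k * E * H) = k * H * (expR (t * a) * E) by ring.
  rewrite ler_peMr ?mulr_ge0 ?(ltW k0) // -expRD -[leLHS]expR0 ler_expR.
  have := lowa (t / n%:R); rewrite tn0 tq => /(_ isT) /(ler_wpM2l (ltW n0)).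
  rewrite (_ : n%:R * (- a * _) = - (t * a)).
    by move: (n%:R * (word_pressure _ - _)) => y; lra.
  by field.
have Szz : S (fun J => - (2 * t) * (w J + g)) <= M * H.
  rewrite /M mulrAC ler_pdivlMr // mulrC.
  rewrite (Sshift _ (2 * t * a) (fun J => (- (2 * t / n%:R)) * ln (phi J))); last first.
    by move=> J; rewrite /w /g; ring.
  have /(ler_wpM2l (expR_ge0 (2 * t * a))) := upm (- (2 * t / n%:R)) n l I tnq tnq'.
  rewrite mulrCA => /le_trans; apply; rewrite mulrA -expRD ler_wpM2r // ler_expR.
  have := up2 (2 * t / n%:R); rewrite le3 tnE mulr_gt0 // => /(_ isT).
  move/(ler_wpM2l (ltW n0)).
  rewrite (_ : n%:R * ((_ - a) * _) = 1 - 2 * t * a).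
    by move: (n%:R * _) => y; lra.
  by field; rewrite nN0 gt_eqF.
have SH : \sum_(J <- all_words n) Z q l (I ++ J) = H by rewrite /H partition_sum_cat.
have main : S w <= expR v * H + expR (- (u * v)) * S (fun J => (u + 1) * w J)
   + e * expR (- (t * (g / 2))) * H
   - e * (S (fun J => - t * (w J + g)) - kap * S (fun J => - (2 * t) * (w J + g))).
  rewrite -SH /S !mulr_sumr -sumrB mulr_sumr -!big_split -sumrB /=.
  apply: ler_sum => J _.
  have /(ler_wpM2l (partition_sum_ge0 q l (I ++ J))) :=
    @expR_le_second_moment R (w J) g t v u kap g0 t0 v0 u0 kap0 e erefl.
  move=> /le_trans; apply; rewrite le_eqVlt; apply/orP; left; apply/eqP; ring.
have kM : kap * M = k / 2 by rewrite /kap; field; rewrite gt_eqF.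
have uM : expR (- (u * v)) * M <= eta by rewrite -ler_pdivlMr.
have b1 : expR (- (u * v)) * S (fun J => (u + 1) * w J) <= eta * H.
  apply: (@le_trans _ _ (expR (- (u * v)) * (M * H))); first by rewrite ler_wpM2l ?expR_ge0.
  by rewrite mulrA ler_wpM2r.
have b2 : e * expR (- (t * (g / 2))) * H <= eta * H.
  by rewrite ler_wpM2r // /eta -mulrA ler_wpM2l // ltW.
have b3 : kap * S (fun J => - (2 * t) * (w J + g)) <= k / 2 * H.
  by rewrite -kM -mulrA ler_wpM2l // ltW.
have b4 : e * (k / 2 * H) <= e * (S (fun J => - t * (w J + g)) -
    kap * S (fun J => - (2 * t) * (w J + g))).
  by rewrite ler_wpM2l ?(ltW e0) //; lra.
have Sw : S w <= expR (- eta) * H.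
  apply: (@le_trans _ _ ((1 - eta) * H)); last first.
    by rewrite ler_wpM2r //; exact: expR_ge1Dx.
  have b5 : e * (k / 2 * H) = 4 * eta * H by rewrite /eta; field.
  rewrite b5 in b4; rewrite vE in main.
  move: main b1 b2 b4; lra.
rewrite -/(S (fun J => n%:R^-1 * ln (phi J))) (Sshift _ b w); last first.
  by move=> J; rewrite /w; ring.
by rewrite expRD -mulrA ler_wpM2l ?expR_ge0.
Qed.

Lemma word_pressure_derivable (q : R) : 0 < q -> derivable word_pressure q 1.
Proof.
move=> q0; apply: convex_derivable => // [x y s t|a b ab lowb lowa upb upa].
  exact: word_pressure_convex.
have [eta [n [eta0 n0 blk]]] := corner_block_bound q0 ab lowa upb upa.
have := pressure_slope_le_of_block_bound q0 _ (expR_gt0 _) blk.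
rewrite invr_ge0 ler0n expRK => /(_ isT).
have nR : 0 < n%:R :> R by rewrite ltr0n.
have := lowb n%:R^-1; rewrite invr_gt0 nR => /(_ isT) /(ler_wpM2l (ltW nR)).
by rewrite mulrCA divff ?gt_eqF // mulr1; lra.
Qed.

End LinkedPotential.

(** * Products of non-negative matrices *)

Definition mx_nneg {R : realType} {d : nat} (B : 'M[R]_d) : Prop :=
  forall a b, 0 <= B a b.

Section SumNorm.
Context {R : realType} {d : nat}.
Implicit Types B C S : 'M[R]_d.

Lemma sum_normE B : sum_norm B = \sum_a \sum_b B a b.
Proof.
rewrite /sum_norm mxE exchange_big /=; apply: eq_bigr => b _.
rewrite !mxE mulr1; apply: eq_bigr => a _; by rewrite mxE mul1r.
Qed.

Lemma sum_norm_ge0 B : mx_nneg B -> 0 <= sum_norm B.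
Proof. by move=> B0; rewrite sum_normE; do 2 (apply: sumr_ge0 => ? _). Qed.

Lemma le_entry_sum_norm B a b : mx_nneg B -> B a b <= sum_norm B.
Proof.
move=> B0; rewrite sum_normE (bigD1 a) //= (bigD1 b) //= -addrA lerDl.
by rewrite addr_ge0 ?sumr_ge0 // => *; rewrite sumr_ge0.
Qed.

Lemma sum_norm_sum (I : Type) (r : seq I) (P : pred I) (F : I -> 'M[R]_d) :
  sum_norm (\sum_(i <- r | P i) F i) = \sum_(i <- r | P i) sum_norm (F i).
Proof. by rewrite /sum_norm mulmx_sumr mulmx_suml summxE. Qed.

Lemma mx_nnegM B C : mx_nneg B -> mx_nneg C -> mx_nneg (B * C).
Proof. by move=> B0 C0 a b; rewrite mxE sumr_ge0 // => k _; exact: mulr_ge0. Qed.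

Lemma sum_normM_le B C : mx_nneg B -> mx_nneg C ->
  sum_norm (B * C) <= sum_norm B * sum_norm C.
Proof.
move=> B0 C0; rewrite [sum_norm (B * C)]sum_normE [sum_norm B]sum_normE mulr_suml.
apply: ler_sum => a _; rewrite mulr_suml.
apply: (@le_trans _ _ (\sum_b \sum_k B a k * C k b)).
  by apply: ler_sum => b _; rewrite mxE.
rewrite exchange_big /=; apply: ler_sum => k _; rewrite -mulr_sumr ler_wpM2l //.
by rewrite sum_normE [leRHS](bigD1 k) //= lerDl sumr_ge0 // => ? _; rewrite sumr_ge0.
Qed.

Lemma sum_norm_mul3_ge (eta : R) B S C : mx_nneg B -> mx_nneg C ->
  (forall a b, eta <= S a b) -> eta * (sum_norm B * sum_norm C) <= sum_norm (B * S * C).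
Proof.
move=> B0 C0 hS; rewrite !sum_normE mulr_suml mulr_sumr; apply: ler_sum => a _.
apply: (@le_trans _ _ (\sum_k \sum_l B a k * S k l * \sum_b C l b)); last first.
  under [leRHS]eq_bigr do rewrite mxE.
  rewrite [leRHS]exchange_big /= [leLHS]exchange_big /=; apply: ler_sum => l _.
  by rewrite mxE -mulr_sumr mulr_suml.
rewrite mulr_suml mulr_sumr; apply: ler_sum => k _; rewrite !mulr_sumr.
apply: ler_sum => l _; have C1 : 0 <= \sum_b C l b by exact: sumr_ge0.
by rewrite mulrCA -mulrA ler_wpM2l // ler_wpM2r.
Qed.

End SumNorm.

Lemma sorted_cat3 (T : eqType) (e : rel T) (x0 : T) (I K J : seq T) :
  K != [::] -> sorted e I -> sorted e J ->
  path e (last x0 I) (rcons K (head x0 J)) -> sorted e (I ++ K ++ J).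
Proof.
case: K => // y K _ sI; rewrite rcons_path => sJ /andP[].
have sKJ z : path e z (y :: K) -> e (last z (y :: K)) (head x0 J) ->
    path e z ((y :: K) ++ J).
  rewrite cat_path => -> /=; case: J sJ => //= j J -> ->; exact.
case: I sI => [|i I] /= sI h1 h2; last by rewrite cat_path sI; exact: sKJ.
by have := sKJ x0 h1 h2 => /= /andP[].
Qed.

Section WordWeight.
Context {R : realType} {m d : nat} (A : 'M[nat]_m) (Ms : 'I_m -> 'M[R]_d).

(** Weight zero on words that are not admissible turns the restriction on words
into submultiplicativity of the weight. *)
Definition word_weight (s : seq 'I_m) : R :=
  if sorted (trans A) s then sum_norm (\prod_(i <- s) Ms i) else 0.

Lemma word_mxE n (J : n.-tuple 'I_m) : word_mx Ms J = \prod_(i <- J) Ms i.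
Proof. by rewrite /word_mx big_tuple. Qed.

Lemma pressure_word_pressure q : q != 0 -> pressure A Ms q = word_pressure word_weight q.
Proof.
move=> q0; rewrite /pressure /word_pressure.
suff E n : \sum_(J in words A n) sum_norm (word_mx Ms J) `^ q = partition_sum word_weight q n [::].
  by under eq_fun do rewrite E.
rewrite /partition_sum (big_all_words_tuple n (fun L => word_weight ([::] ++ L) `^ q)).
rewrite big_mkcond /=; apply: eq_bigr => J _.
by rewrite /word_weight inE word_mxE; case: ifP => // _; rewrite powR0.
Qed.

Hypothesis Ms0 : forall i, mx_nneg (Ms i).

Lemma mx_nneg_prod s : mx_nneg (\prod_(i <- s) Ms i).
Proof.
elim: s => [|i s IH]; last by rewrite big_cons; exact: mx_nnegM.
by rewrite big_nil => a b; rewrite mxE ler0n.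
Qed.

Lemma word_weight_ge0 s : 0 <= word_weight s.
Proof. by rewrite /word_weight; case: ifP => // _; exact/sum_norm_ge0/mx_nneg_prod. Qed.

Lemma word_weight_cat s1 s2 :
  word_weight (s1 ++ s2) <= word_weight s1 * word_weight s2.
Proof.
rewrite {1}/word_weight; case: ifP => [|_]; last by rewrite mulr_ge0 ?word_weight_ge0.
move=> /cat_sorted2[s1s s2s]; rewrite /word_weight s1s s2s big_cat.
by apply: sum_normM_le; exact: mx_nneg_prod.
Qed.

Lemma word_weight_nil : (0 < d)%N -> 0 < word_weight [::].
Proof.
move=> d0; rewrite /word_weight /=.
apply: lt_le_trans (le_entry_sum_norm (Ordinal d0) (Ordinal d0) (mx_nneg_prod [::])).
by rewrite big_nil mxE eqxx ltr01.
Qed.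

(** Sandwiching the positive matrix of (H2) between M_I and M_J costs at most the
factor eta, its smallest entry.  It is a sum of a bounded number of matrices
M_K, so one of them alone achieves a fixed proportion of the bound. *)
Lemma word_weight_link (r : nat) : (0 < m)%N -> (0 < r)%N ->
  (forall i j a b, 0 < (\sum_(1 <= k < r.+1)
    \sum_(K in connecting_words A k i j) word_mx Ms K) a b) ->
  exists (r : nat) (c : R), 0 < c /\ forall I J, exists2 K,
    (0 < size K <= r)%N & c * (word_weight I * word_weight J) <= word_weight (I ++ K ++ J).
Proof.
move=> m0 r0 H2; pose i0 := Ordinal m0.
pose S i j := \sum_(1 <= k < r.+1) \sum_(K in connecting_words A k i j) word_mx Ms K.
pose eta := \big[Num.min/1]_(x : 'I_m * 'I_m * ('I_d * 'I_d)) S x.1.1 x.1.2 x.2.1 x.2.2.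
have eta0 : 0 < eta by apply: lt_bigmin => // x _; exact: H2.
have etaS i j a b : eta <= S i j a b.
  exact: (bigmin_le _ ((i, j), (a, b)) (fun x => S x.1.1 x.1.2 x.2.1 x.2.2)).
pose N : R := \sum_(1 <= k < r.+1) \sum_(K : k.-tuple 'I_m) 1.
have N0 : 0 <= N by do 2 (apply: sumr_ge0 => ? _).
have N1 : 0 < N + 1 by lra.
exists r, (eta / (N + 1)); split; first by rewrite divr_gt0.
move=> I J; pose X := word_weight I * word_weight J.
have [X0|X0] := eqVneq X 0.
  by exists [:: i0]; rewrite // -/X X0 mulr0 word_weight_ge0.
have Xp : 0 < X by rewrite lt0r X0 mulr_ge0 ?word_weight_ge0.
have sorted_of K L : word_weight K * word_weight L != 0 -> sorted (trans A) K.
  by rewrite /word_weight; case: ifP => // _; rewrite mul0r eqxx.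
have sI : sorted (trans A) I by exact: sorted_of X0.
have sJ : sorted (trans A) J by move: X0; rewrite /X mulrC; exact: sorted_of.
pose i := last i0 I; pose j := head i0 J.
pose MI := \prod_(i <- I) Ms i; pose MJ := \prod_(i <- J) Ms i.
have XE : X = sum_norm MI * sum_norm MJ by rewrite /X /word_weight sI sJ.
have big : eta * X <= \sum_(1 <= k < r.+1) \sum_(K in connecting_words A k i j)
    sum_norm (MI * word_mx Ms K * MJ).
  rewrite XE; apply: le_trans (sum_norm_mul3_ge _ _ (etaS i j)) _; try exact: mx_nneg_prod.
  rewrite /S mulr_sumr mulr_suml sum_norm_sum le_eqVlt; apply/orP; left; apply/eqP.
  by apply: eq_bigr => k _; rewrite mulr_sumr mulr_suml sum_norm_sum.
apply: contrapT => none.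
(* Otherwise every term falls short of its share eta / (N + 1) * X, where N is
   the number of candidates K. *)
have small k (K : k.-tuple 'I_m) : (1 <= k < r.+1)%N -> K \in connecting_words A k i j ->
    sum_norm (MI * word_mx Ms K * MJ) <= eta / (N + 1) * X.
  move=> /andP[k1 kr]; rewrite inE => /andP[_]; rewrite inE => sK.
  rewrite leNgt; apply/negP => lt; apply: none; exists K.
    by rewrite size_tuple k1 -ltnS.
  have sIKJ : sorted (trans A) (I ++ K ++ J).
    by apply: (@sorted_cat3 _ _ i0) => //; rewrite -size_eq0 size_tuple -lt0n.
  apply: (le_trans (ltW lt)).
  by rewrite /word_weight sIKJ !big_cat /= mulrA word_mxE.
suff : eta * X <= eta / (N + 1) * X * N.
  rewrite mulrAC ler_pM2r // mulrAC ler_pdivlMr // ler_pM2l //; lra.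
apply: (le_trans big); rewrite mulr_sumr big_nat_cond [leRHS]big_nat_cond.
apply: ler_sum => k; rewrite andbT => kr; rewrite mulr_sumr mulr1 big_mkcond /=.
apply: ler_sum => K _; case: ifP => [/(small _ _ kr)//|_].
by rewrite mulr_ge0 ?(ltW Xp) // divr_ge0 ?(ltW eta0) ?(ltW N1).
Qed.

End WordWeight.

(** Primitivity leaves no letter without a successor, so every letter starts an
infinite admissible sequence.  This is how M, defined on sequences only,
determines each M_i and makes it non-negative. *)
Lemma SFT_point (m : nat) (A : 'M[nat]_m) : mx01 A -> primitive_mx A ->
  forall i, exists x, cylinder A [tuple i] x.
Proof.
move=> A01 [[//|p] _ Ap] i.
have succ k : exists l, trans A k l.
  apply: contrapT => none; have := Ap k k; rewrite exprS mxE big1 // => l _.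
  case: (A01 k l) => [->|Akl]; first by rewrite mul0r.
  by case: none; exists l; rewrite /trans Akl.
have [f hf] := boolp.choice succ.
exists (fun k => iter k f i); split; first by move=> k; exact: hf.
by move=> k; rewrite (ord1 k).
Qed.

Theorem theorem3p3 (R : realType) (m d : nat) (A : 'M[nat]_m)
    (m_ge2 : (2 <= m)%N) (d_gt0 : (0 < d)%N)
    (A01 : mx01 A) (A_primitive : primitive_mx A)
    (M : SFT A -> 'M[R]_d)
    (M_ge0 : forall (x : SFT A) (a b : 'I_d), 0 <= M x a b)
    (Ms : 'I_m -> 'M[R]_d)
    (H1 : forall (i : 'I_m) (x : SFT A),
        cylinder A [tuple i] (val x) -> M x = Ms i)
    (H2 : exists2 r : nat, (0 < r)%N &
        forall (i j : 'I_m) (a b : 'I_d),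
          0 < (\sum_(1 <= k < r.+1)
                 \sum_(K in connecting_words A k i j) word_mx Ms K) a b)
    (q : R) (q_gt0 : 0 < q) :
  derivable (pressure A Ms) q 1.
Proof.
have Ms0 i : mx_nneg (Ms i).
  move=> a b; have [x xi] := SFT_point A01 A_primitive i.
  have xA : x \in SFT A by rewrite inE; case: xi.
  by rewrite -(H1 i (exist _ x xA)).
have m0 : (0 < m)%N by exact: ltnW.
have [r r0 H] := H2.
apply: (@near_eq_derivable _ _ _ (word_pressure (word_weight A Ms))); last first.
  apply: word_pressure_derivable => //.
  - exact: word_weight_ge0.
  - exact: word_weight_cat.
  - exact: word_weight_nil.
  - exact: (word_weight_link Ms0 m0 r0 H).
near=> x; rewrite pressure_word_pressure // gt_eqF //.
near: x; exact: lt_nbhsr.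
Unshelve. all: by end_near.
Qed.
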